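(* Let $H$ be a complex Hilbert space, let $\{f_k\}_{k=1}^\infty$ be a Riesz basis for $H$, let $\{g_k\}_{k=1}^\infty$ be a Bessel sequence in $H$, and let $G$ be the cross-Gram operator associated to $\{\langle f_k,g_j\rangle\}_{j,k=1}^\infty$. Then the following hold: (i) If $\{g_k\}_{k=1}^\infty$ is not a frame for $H$, then $G$ is not invertible. (ii) If $\{g_k\}_{k=1}^\infty$ is not norm-bounded above or not norm-bounded below, then $G$ is not invertible.
   Context: Inner products are linear in the first argument. A sequence $\{g_k\}_{k=1}^\infty\subset H$ is a frame for $H$ if there are constants $A,B>0$ with $A\|f\|^2\le\sum_{k=1}^\infty|\langle f,g_k\rangle|^2\le B\|f\|^2$ for all $f\in H$; it is a Bessel sequence if the second inequality holds for some $B>0$ and all $f\in H$. A Riesz basis for $H$ is a family of the form $\{Ue_k\}_{k=1}^\infty$, where $\{e_k\}_{k=1}^\infty$ is an orthonormal basis for $H$ and $U:H\to H$ is a bounded bijective linear operator. A sequence $\{g_k\}$ is norm-bounded above if $\sup_k\|g_k\|<\infty$ and norm-bounded below if $\inf_k\|g_k\|>0$. The cross-Gram operator associated to $\{\langle f_k,g_j\rangle\}_{j,k=1}^\infty$ is the bounded operator $G:\ell^2(\mathbb{N})\to\ell^2(\mathbb{N})$, $G\{c_k\}_{k=1}^\infty=\left\{\left\langle\sum_{\ell=1}^\infty c_\ell f_\ell,g_j\right\rangle\right\}_{j=1}^\infty$, whose matrix has $(j,k)$ entry $\langle f_k,g_j\rangle$. Invertible means bijective with bounded inverse. *)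

(* Defs.v *)
From HB Require Import structures.
From mathcomp Require Import all_boot all_order all_algebra.
From mathcomp Require Import complex.
From mathcomp Require Import all_classical all_reals all_analysis.

Set Implicit Arguments.
Unset Strict Implicit.
Unset Printing Implicit Defensive.

Import Order.TTheory GRing.Theory Num.Theory Num.Def.
Import numFieldNormedType.Exports.

Local Open Scope classical_set_scope.
Local Open Scope ring_scope.
Local Open Scope complex_scope.

(* A norm over the scalar field [R[i]] takes its values in [R[i]], where they
   are real and nonnegative; [rnorm x] is the same number, as an element of [R].
   It applies both to vectors and to scalars. *)
Definition rnorm (R : realType) (V : normedZmodType R[i]) (x : V) : R :=
  complex.Re `|x|.

Definition inner_product_of_norm (R : realType) (H : normedModType R[i])
    (ip : {dot H for conjC}) : Prop :=
  forall x : H, ip x x = `|x| ^+ 2.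

Definition orthonormal_system (R : realType) (H : normedModType R[i])
    (ip : {dot H for conjC}) (e : nat -> H) : Prop :=
  forall j k : nat, ip (e j) (e k) = (j == k)%:R.

Definition linear_span (R : realType) (H : normedModType R[i])
    (e : nat -> H) : set H :=
  [set x | exists n (a : nat -> R[i]), x = \sum_(k < n) a k *: e k].

Definition orthonormal_basis (R : realType) (H : normedModType R[i])
    (ip : {dot H for conjC}) (e : nat -> H) : Prop :=
  orthonormal_system ip e /\ closure (linear_span e) = [set: H].

Definition riesz_basis (R : realType) (H : normedModType R[i])
    (ip : {dot H for conjC}) (f : nat -> H) : Prop :=
  exists e : nat -> H, exists U : {linear H -> H},
    [/\ orthonormal_basis ip e,
        exists M : R, forall x : H, rnorm (U x) <= M * rnorm x,
        bijective U
      & forall k, f k = U (e k)].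

Definition sqsum (R : realType) (c : nat -> R[i]) : \bar R :=
  (\sum_(0 <= k <oo) ((rnorm (c k)) ^+ 2)%:E)%E.

Definition bessel (R : realType) (H : normedModType R[i])
    (ip : {dot H for conjC}) (g : nat -> H) : Prop :=
  exists2 B : R, 0 < B &
    forall f : H, (sqsum (fun k => ip f (g k)) <= (B * rnorm f ^+ 2)%:E)%E.

Definition frame (R : realType) (H : normedModType R[i])
    (ip : {dot H for conjC}) (g : nat -> H) : Prop :=
  exists A B : R, [/\ 0 < A, 0 < B &
    forall f : H,
      ((A * rnorm f ^+ 2)%:E <= sqsum (fun k => ip f (g k)) <=
       (B * rnorm f ^+ 2)%:E)%E].

Definition norm_bounded_above (R : realType) (H : normedModType R[i])
    (g : nat -> H) : Prop :=
  (ereal_sup (range (fun k => (rnorm (g k))%:E)) < +oo)%E.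

Definition norm_bounded_below (R : realType) (H : normedModType R[i])
    (g : nat -> H) : Prop :=
  (0 < ereal_inf (range (fun k => (rnorm (g k))%:E)))%E.

Definition ell2 (R : realType) : set (nat -> R[i]) :=
  [set c | (sqsum c < +oo)%E].
Arguments ell2 : clear implicits.

Definition ell2norm (R : realType) (c : nat -> R[i]) : R :=
  Num.sqrt (fine (sqsum c)).

(* The limit is that of the partial sums in the norm of [H]; it exists for every
   [c] in [ell2 R] when [f] is a Riesz basis. Outside [ell2 R] the value is
   irrelevant. *)
Definition cross_gram (R : realType) (H : normedModType R[i])
    (ip : {dot H for conjC}) (f g : nat -> H) (c : nat -> R[i]) : nat -> R[i] :=
  fun j => ip (limn (series (fun l => c l *: f l))) (g j).

(* [G] is viewed as an operator from [ell2 R] to [ell2 R], and [S] as its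
   inverse; only their values on [ell2 R] matter. *)
Definition invertible_on_ell2 (R : realType)
    (G : (nat -> R[i]) -> (nat -> R[i])) : Prop :=
  set_bij (ell2 R) (ell2 R) G /\
  exists S : (nat -> R[i]) -> (nat -> R[i]),
    (forall c, ell2 R c -> S (G c) = c) /\
    exists M : R, forall c, ell2 R c -> ell2norm (S c) <= M * ell2norm c.

(* Main.v *)
Require Import Defs.
From HB Require Import structures.
From mathcomp Require Import all_boot all_order all_algebra.
From mathcomp Require Import complex.
From mathcomp Require Import all_classical all_reals all_analysis.

(* Let [f k = U (e k)]. For [x] in [H], the sequence [c] of coordinates of
   [U^-1 x] in the basis [e] satisfies [G c = (<x, g j>)_j] and
   [|x| <= |U| |c|]. If [G] has a bounded inverse, then
   [|x| <= K |(<x, g j>)_j|], which is the lower frame inequality. Moreover, by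
   surjectivity some [x] satisfies [<x, g k> = (j == k)] for all [k], so that
   [1 <= |x| |g j| <= K |g j|]: [g] is bounded below. It is bounded above because
   it is a Bessel sequence. *)

Import Order.TTheory GRing.Theory Num.Theory Num.Def.
Import numFieldNormedType.Exports.
Local Open Scope ring_scope.
Local Open Scope complex_scope.

(** * Real-valued norms and square-summable sequences *)

Section Rnorm.
Context {R : realType}.

Lemma normr_rnorm (V : normedZmodType R[i]) (x : V) : `|x| = (rnorm x)%:C.
Proof. by rewrite /rnorm RRe_real // normr_real. Qed.

Lemma rnorm_ge0 (V : normedZmodType R[i]) (x : V) : 0 <= rnorm x.
Proof. by rewrite -lecR -normr_rnorm normr_ge0. Qed.

Lemma ler_dist_rnorm (V : normedZmodType R[i]) (x y : V) :
  `|rnorm x - rnorm y| <= rnorm (x - y).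
Proof.
rewrite -lecR -normr_rnorm; have := lerB_dist x y; have := lerB_dist y x.
rewrite distrC !normr_rnorm -!rmorphB !lecR => h1 h2.
by rewrite ler_norml h2 andbT lerNl opprB.
Qed.

Lemma cvg_rnorm (V : normedModType R[i]) (u : nat -> V) (x : V) :
  (u @ \oo --> x)%classic -> ((fun n => rnorm (u n)) @ \oo --> rnorm x)%classic.
Proof.
move=> ux; apply/cvgrPdist_lt => eps eps0.
have eps0C : 0 < eps%:C by rewrite ltcR.
move/cvgrPdist_lt: ux => /(_ _ eps0C); apply: filterS => n.
rewrite normr_rnorm ltcR; apply: le_lt_trans; exact: ler_dist_rnorm.
Qed.

Lemma ell2norm_ge0 (c : nat -> R[i]) : 0 <= ell2norm c.
Proof. exact: sqrtr_ge0. Qed.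

Lemma sqr_ell2norm (c : nat -> R[i]) :
  ell2 R c -> (ell2norm c ^+ 2)%:E = sqsum c.
Proof.
move=> cfin; have c0 : (0 <= sqsum c)%E.
  by apply: nneseries_ge0 => k _ _; rewrite lee_fin sqr_ge0.
rewrite /ell2norm sqr_sqrtr ?fine_ge0 // fineK // ge0_fin_numE //.
Qed.

(** Unit sequences are the targets at which surjectivity of the cross-Gram operator is used to bound
    [g] below. *)
Lemma ell2_delta (j : nat) : ell2 R (fun k => (j == k)%:R) /\
  ell2norm (fun k => (j == k)%:R : R[i]) = 1.
Proof.
suff d1 : sqsum (fun k => (j == k)%:R : R[i]) = 1%E.
  by rewrite /ell2 /ell2norm /= d1 ltry sqrtr1.
rewrite /sqsum (@nneseriesD1 _ _ j) //; last first.
  by move=> k _; rewrite lee_fin sqr_ge0.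
rewrite eqxx eseries0 => [|k _ kj].
  by rewrite adde0 /rnorm normr1 expr1n.
by rewrite eq_sym (negPf kj) /rnorm normr0 expr0n.
Qed.

End Rnorm.

(** * Orthogonality and the Cauchy-Schwarz inequality *)

Section InnerProduct.
Context {R : realType} {H : normedModType R[i]} (ip : {dot H for conjC}).
Hypothesis ipE : inner_product_of_norm ip.

Lemma normr_ipD x y : ip x y = 0 -> `|x + y| ^+ 2 = `|x| ^+ 2 + `|y| ^+ 2.
Proof. by move=> xy0; rewrite -!ipE hnormDd. Qed.

(** Pythagoras applied to [x = (x - a *: y) + a *: y], where [a *: y] is the projection of [x] on
    [y], of norm [|ip x y| / |y|]. *)
Lemma dot_cauchy_schwarz x y : `|ip x y| <= `|x| * `|y|.
Proof.
have [->|y0] := eqVneq y 0; first by rewrite linear0r !normr0 mulr0.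
have ny0 : 0 < `|y| by rewrite normr_gt0.
pose a := ip x y / `|y| ^+ 2.
have xay : ip (x - a *: y) (a *: y) = 0.
  rewrite linearZr_LR linearBl linearZl_LR /= ipE /a mulfVK ?subrr ?mulr0 //.
  by rewrite expf_neq0 // gt_eqF.
rewrite -ler_pdivrMr //; rewrite -(@ler_pXn2r _ 2) ?nnegrE ?divr_ge0 //.
rewrite -[X in _ <= `|X| ^+ 2](subrK (a *: y)) normr_ipD // normrZ /a.
rewrite normrM normfV normrX normr_id.
suff -> : `|ip x y| / `|y| = `|ip x y| / `|y| ^+ 2 * `|y|.
  by rewrite lerDr exprn_ge0.
by rewrite expr2 invfM mulrA mulfVK // gt_eqF.
Qed.

(** * Fourier expansions in an orthonormal basis *)

Section Fourier.
Variable e : nat -> H.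
Hypothesis eo : orthonormal_system ip e.

Let S x n : H := \sum_(k < n) ip x (e k) *: e k.

Lemma dot_fourier_residual x n (a : nat -> R[i]) :
  ip (x - S x n) (\sum_(k < n) a k *: e k) = 0.
Proof.
rewrite linear_sumr big1 // => k _; rewrite linearZr_LR /=.
suff -> : ip (x - S x n) (e k) = 0 by rewrite mulr0.
rewrite linearBl linear_sumlz (bigD1 k) //= linearZl_LR /= eo eqxx mulr1.
rewrite big1 ?addr0 ?subrr // => j jk.
by rewrite linearZl_LR /= eo (inj_eq val_inj) (negPf jk) mulr0.
Qed.

(** The residual [x - S x n] is orthogonal to [S x n] itself, so the left side is [ip x (S x n)],
    which expands term by term. *)
Lemma normr_fourier_sum x n :
  `|S x n| ^+ 2 = \sum_(k < n) `|ip x (e k)| ^+ 2.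
Proof.
have := dot_fourier_residual x n (fun k => ip x (e k)).
rewrite linearBl /= -/(S x n) ipE => /eqP; rewrite subr_eq0 => /eqP <-.
rewrite linear_sumr; apply: eq_bigr => k _.
by rewrite linearZr_LR /= mulrC -normCK.
Qed.

Lemma fourier_best_approx x m n (a : nat -> R[i]) : (m <= n)%N ->
  `|x - S x n| <= `|x - \sum_(k < m) a k *: e k|.
Proof.
(* Zero padding puts the competitor in the span of the first [n] vectors, to which the residual is
   orthogonal; Pythagoras then applies. *)
move=> mn; pose b k := if (k < m)%N then a k else 0.
have -> : \sum_(k < m) a k *: e k = \sum_(k < n) b k *: e k.
  rewrite (big_ord_widen n (fun k => a k *: e k) mn) big_mkcond.
  by apply: eq_bigr => k _; rewrite /b; case: ifP => //; rewrite scale0r.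
rewrite -(@ler_pXn2r _ 2) ?nnegrE //.
rewrite -[X in _ <= `|X - _| ^+ 2](subrK (S x n)) -addrA.
rewrite (@normr_ipD (x - S x n)) ?lerDl ?exprn_ge0 //.
rewrite linearBr /= (dot_fourier_residual x n (fun k => ip x (e k))).
by rewrite dot_fourier_residual subrr.
Qed.

Hypothesis ed : closure (linear_span e) = [set: H]%classic.

(** Density gives one combination of length [m] within [eps] of [x]; by best approximation, every
    partial sum from [m] on is at least as close. *)
Lemma cvg_fourier x : (series (fun k => ip x (e k) *: e k) @ \oo --> x)%classic.
Proof.
apply/cvgrPdist_lt => eps eps0.
have xcl : closure (linear_span e) x by rewrite ed.
have [y [[m [a ->]] /=]] := xcl _ (nbhsx_ballx x eps eps0).
rewrite -ball_normE /= => xy.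
exists m => // n /= mn; rewrite /series /= big_mkord.
by apply: le_lt_trans xy; apply: fourier_best_approx.
Qed.

Lemma parseval x : sqsum (fun k => ip x (e k)) = (rnorm x ^+ 2)%:E.
Proof.
rewrite /sqsum; apply/cvg_lim => //.
have -> : (fun n => \sum_(0 <= k < n) (rnorm (ip x (e k)) ^+ 2)%:E)%E
   = (fun n => (rnorm (S x n) ^+ 2)%:E).
  apply/funext => n; rewrite sumEFin big_mkord; congr EFin.
  apply: complexI; rewrite rmorphXn /= -normr_rnorm normr_fourier_sum rmorph_sum.
  by apply: eq_bigr => k _; rewrite rmorphXn /= -normr_rnorm.
apply: cvg_EFin; first by near=> n.
under eq_fun do rewrite /= expr2.
rewrite expr2; suff h : ((fun n => rnorm (S x n)) @ \oo --> rnorm x)%classic.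
  exact: cvgM.
apply: cvg_rnorm; have -> // : S x = series (fun k => ip x (e k) *: e k).
  by apply/funext => n; rewrite /series /= big_mkord.
exact: cvg_fourier.
Unshelve. all: by end_near. Qed.

End Fourier.
End InnerProduct.

(** * Riesz bases and invertibility of the cross-Gram operator *)

Section CrossGram.
Context {R : realType} {H : normedModType R[i]} (ip : {dot H for conjC}).
Context (f g : nat -> H).
Hypothesis ipE : inner_product_of_norm ip.

(* The coefficients are those of [U^-1 x] in the orthonormal basis that [U]
   sends to [f], so the bound only involves the norm of [U], not of [U^-1]. *)
Lemma riesz_basis_coefs : riesz_basis ip f ->
  exists2 K : R, 0 < K & forall x, exists c,
    [/\ ell2 R c, rnorm x <= K * ell2norm c
      & cross_gram ip f g c = (fun j => ip x (g j))].
Proof.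
move=> [e [U [[eo ed] [M UM] [V VU UV] fU]]].
(* The sign of [M] is unknown; [|M| + 1] is a positive bound for [U]. *)
exists (`|M| + 1) => [|x]; first by rewrite ltr_wpDl.
have UMx y : rnorm (U y) <= (`|M| + 1) * rnorm y.
  apply: le_trans (UM y) _; rewrite ler_wpM2r ?rnorm_ge0 //.
  by apply: le_trans (ler_norm M) _; rewrite lerDl.
have Ps := parseval ip ipE e eo ed (V x).
have cl : ell2 R (fun k => ip (V x) (e k)) by rewrite /ell2 /= Ps ltry.
exists (fun k => ip (V x) (e k)); split=> //.
  apply: le_trans (_ : (`|M| + 1) * rnorm (V x) <= _).
    by rewrite -{1}(UV x).
  rewrite ler_wpM2l ?addr_ge0 // -(@ler_pXn2r _ 2) ?nnegrE ?rnorm_ge0 //.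
    by rewrite -lee_fin sqr_ell2norm // Ps.
  exact: ell2norm_ge0.
apply/funext => j; rewrite /cross_gram; congr (ip _ _).
apply/cvg_lim => //; apply/cvgrPdist_lt => eps eps0.
have K0 : 0 < (`|M| + 1)%:C by rewrite ltcR ltr_wpDl.
(* The error of the series in [f] is the image under [U] of the Fourier error of [V x], hence this
   tolerance. *)
have /cvgrPdist_lt/(_ (eps / (`|M| + 1)%:C)) := cvg_fourier ip ipE e eo ed (V x).
rewrite divr_gt0 // => /(_ isT); apply: filterS => n.
rewrite ltr_pdivlMr //; apply: le_lt_trans.
rewrite mulrC !normr_rnorm -rmorphM lecR.
apply: le_trans (UMx _); rewrite linearB UV /series /= (raddf_sum U) /=.
by under eq_bigr do rewrite fU -linearZ.
Qed.

Lemma invertible_cross_gram_lower_bound :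
  riesz_basis ip f -> invertible_on_ell2 (cross_gram ip f g) ->
  exists2 K : R, 0 < K & forall x,
    ell2 R (fun j => ip x (g j)) /\
    rnorm x <= K * ell2norm (fun j => ip x (g j)).
Proof.
move=> /riesz_basis_coefs[K K0 Kx] [[Gfun _ _] [S [SG [M SM]]]].
exists (K * (`|M| + 1)) => [|x]; first by rewrite mulr_gt0 // ltr_wpDl.
have [c [cl xc Gc]] := Kx x.
have := Gfun _ cl; rewrite Gc => dl; split=> //.
apply: le_trans xc _; rewrite -mulrA ler_pM2l //.
(* Writing [c] as [S (G c)] lets the bound on [S] control the norm of [c]. *)
rewrite -{1}(SG _ cl) Gc; apply: le_trans (SM _ dl) _.
rewrite ler_wpM2r ?ell2norm_ge0 //.
by apply: le_trans (ler_norm M) _; rewrite lerDl.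
Qed.

Lemma invertible_cross_gram_frame :
  riesz_basis ip f -> bessel ip g ->
  invertible_on_ell2 (cross_gram ip f g) -> frame ip g.
Proof.
move=> rf [B B0 gB] /(invertible_cross_gram_lower_bound rf)[K K0 Kx].
exists (K ^- 2), B; split=> // [|x]; first by rewrite invr_gt0 exprn_gt0.
rewrite gB andbT; have [dl xK] := Kx x.
rewrite -sqr_ell2norm // lee_fin mulrC ler_pdivrMr ?exprn_gt0 //.
rewrite mulrC -exprMn ler_pXn2r ?nnegrE ?rnorm_ge0 //.
by rewrite mulr_ge0 ?ell2norm_ge0 // ltW.
Qed.

(** Testing the Bessel inequality at [g k] and keeping only the term of index [k] gives
    [|g k|^4 <= B |g k|^2]. *)
Lemma bessel_norm_bounded_above : bessel ip g -> norm_bounded_above g.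
Proof.
move=> [B B0 gB]; apply: le_lt_trans (ltry (Num.sqrt B)).
apply: ge_ereal_sup => _ [k _ <-]; rewrite lee_fin.
have [->|gk0] := eqVneq (rnorm (g k)) 0; first exact: sqrtr_ge0.
have gk : 0 < rnorm (g k) by rewrite lt_def gk0 rnorm_ge0.
rewrite -(@ler_pXn2r _ 2) ?nnegrE ?sqrtr_ge0 ?rnorm_ge0 // (sqr_sqrtr (ltW B0)).
rewrite -(@ler_pM2r _ (rnorm (g k) ^+ 2)) ?exprn_gt0 //.
rewrite -lee_fin; apply: le_trans (gB (g k)).
have -> : rnorm (g k) ^+ 2 * rnorm (g k) ^+ 2
   = rnorm (ip (g k) (g k)) ^+ 2.
  rewrite -expr2; congr (_ ^+ 2); apply: complexI.
  by rewrite rmorphXn /= -!normr_rnorm ipE normrX normr_id.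
rewrite /sqsum; apply: le_trans (nneseries_lim_ge k.+1 _) => [|j _ _].
  rewrite big_nat_recr //= leeDr // sume_ge0 // => j _.
  by rewrite lee_fin sqr_ge0.
by rewrite lee_fin sqr_ge0.
Qed.

Lemma invertible_cross_gram_norm_bounded_below :
  riesz_basis ip f -> invertible_on_ell2 (cross_gram ip f g) ->
  norm_bounded_below g.
Proof.
move=> rf Ginv; have [K K0 Kx] := invertible_cross_gram_lower_bound rf Ginv.
apply: (@lt_le_trans _ _ (K^-1)%:E); first by rewrite lte_fin invr_gt0.
apply: le_ereal_inf_tmp => _ [j _ <-]; rewrite lee_fin.
have [[_ _ Gsurj] _] := Ginv; have [dl dn] := @ell2_delta R j.
have [c _ Gc] := Gsurj _ dl.
(* By definition of [cross_gram], [G c] lists the products [ip x (g k)], whatever value [limn]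
   returns. *)
pose x := limn (series (fun l => c l *: f l)).
have xg : (fun k => ip x (g k)) = (fun k => (j == k)%:R) by rewrite -Gc.
have [_] := Kx x; rewrite xg dn mulr1 => xK.
have xgj : ip x (g j) = 1 by rewrite [LHS](congr1 (@^~ j) xg) eqxx.
have := dot_cauchy_schwarz ip ipE x (g j).
rewrite xgj normr1 !normr_rnorm -rmorphM -(rmorph1 (real_complex R)) lecR => gj1.
rewrite -[K^-1]mul1r ler_pdivrMr // mulrC; apply: le_trans gj1 _.
by rewrite ler_wpM2r ?rnorm_ge0.
Qed.

End CrossGram.

Theorem corollary2p12 (R : realType) (H : completeNormedModType R[i])
    (ip : {dot H for conjC}) (f g : nat -> H) :
  inner_product_of_norm ip ->
  riesz_basis ip f ->
  bessel ip g ->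
  (~ frame ip g -> ~ invertible_on_ell2 (cross_gram ip f g)) /\
  (~ norm_bounded_above g \/ ~ norm_bounded_below g ->
     ~ invertible_on_ell2 (cross_gram ip f g)).
Proof.
move=> ipE rf gB; split=> [gF /(invertible_cross_gram_frame ip f g ipE rf gB)//|].
move=> [[]|gB' /(invertible_cross_gram_norm_bounded_below ip f g ipE rf)//].
exact: bessel_norm_bounded_above ipE gB.
Qed.
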